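(* Let $g(n)$ denote the largest cardinality of a spherical two-distance set in $\mathbf{R}^n$. If $n$ is an integer with $6<n<22$ or $23<n<40$, then $$g(n)=\frac{n(n+1)}{2}.$$ For $n=23$, one has $g(23)=276$ or $g(23)=277$.
   Context: A spherical two-distance set in $\mathbf{R}^n$ is a set $S$ of unit vectors in $\mathbf{R}^n$ for which there exist real numbers $a,b$ with $-1\le a,b<1$ such that the inner product of any two distinct vectors of $S$ is either $a$ or $b$. *)

(* Defs.v *)
From HB Require Import structures.
From mathcomp Require Import all_boot all_order all_algebra.
From mathcomp Require Import boolp classical_sets functions cardinality reals.

Set Implicit Arguments.
Unset Strict Implicit.
Unset Printing Implicit Defensive.

Import Order.TTheory GRing.Theory Num.Theory.

Local Open Scope classical_set_scope.
Local Open Scope ring_scope.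

Definition dot (R : realType) (n : nat) (u v : 'rV[R]_n) : R :=
  \sum_(i < n) u 0 i * v 0 i.

(* The norm that the topology library puts on row vectors is the sup norm, so
   the Euclidean one is defined here. *)
Definition enorm (R : realType) (n : nat) (u : 'rV[R]_n) : R :=
  Num.sqrt (dot u u).

(* S is not assumed finite, a and b may coincide, and neither value has to be
   attained. *)
Definition spherical_two_distance (R : realType) (n : nat)
    (S : set 'rV[R]_n) : Prop :=
  (forall u, S u -> enorm u = 1) /\
  exists a b : R,
    [/\ -1 <= a < 1, -1 <= b < 1 &
        forall u v, S u -> S v -> u <> v -> dot u v = a \/ dot u v = b].

(* "g(n) exists and equals m": m is attained as a cardinality, and it bounds
   the cardinality of every (possibly infinite) spherical two-distance set. *)
Definition g_eq (R : realType) (n m : nat) : Prop :=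
  (exists2 S : set 'rV[R]_n, spherical_two_distance S & (S #= `I_m)%card) /\
  (forall S : set 'rV[R]_n, spherical_two_distance S -> (S #<= `I_m)%card).

(* Main.v *)
(* Let u, v range over N unit vectors of R^n whose inner products are a >= b.

   If a + b >= 0, the symmetric matrices u^T u + a b I are linearly independent,
   because the matrix of the values v (u^T u + a b I) v^T is positive definite;
   so N <= n (n + 1) / 2.

   If a + b < 0 and N > 2 n + 2, then (1 - b) / (a - b) is an integer k >= 2
   (Larman, Rogers and Seidel): its opposite is an eigenvalue of multiplicity more
   than N / 2 of an integer matrix of order N. Comparing the trace of a Gram
   matrix of rank n + 1 with that of its square gives
   (2 k - 1)^2 (N - n - 1) <= (n + 1) (N - 1), so that in the range at hand k = 2,
   or k = 3 and n > 22. This leaves one real unknown a, with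
   b = (k a - 1) / (k - 1). For the Gegenbauer polynomials P_d of degree d <= 4,
   P_d(u.v) is an inner product of traceless symmetric tensors, hence the Delsarte
   inequalities sum_(u, v) P_d(u.v) >= 0. They form a linear program in the numbers
   of pairs at inner product a and b; when N exceeds the bound, at most two of them
   are already contradictory, which is checked by bisection on a in exact integer
   arithmetic.

   The midpoints of the edges of a regular simplex attain n (n + 1) / 2. *)
From Stdlib Require Import ZArith.
Require Import Defs.
From mathcomp Require Import boolp classical_sets functions cardinality.
From mathcomp Require Import all_boot all_order all_algebra.
From mathcomp Require Import reals.
From mathcomp Require Import ring lra zify ssrZ.

Set Implicit Arguments.
Unset Strict Implicit.
Unset Printing Implicit Defensive.

Import Order.TTheory GRing.Theory Num.Theory.

Local Open Scope ring_scope.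

(** * Delsarte inequalities *)

Section Harmonic.
Variables (R : realType) (n : nat).
Implicit Types (u v : 'rV[R]_n).

Local Notation "''d_' ( i , j )" := ((i == j :> 'I_n)%:R : R) (at level 0).

Lemma sum_delta (j : 'I_n) (f : 'I_n -> R) : \sum_i 'd_(i, j) * f i = f j.
Proof.
rewrite (bigD1 j) //= eqxx mul1r big1 ?addr0 // => i /negPf ->.
by rewrite mul0r.
Qed.

Lemma sum_delta_diag : \sum_(i < n) 'd_(i, i) = n%:R.
Proof. by rewrite (eq_bigr (fun=> 1)) ?sumr_const ?card_ord // => i; rewrite eqxx. Qed.

Lemma delta_sym (i j : 'I_n) : 'd_(i, j) = 'd_(j, i).
Proof. by rewrite eq_sym. Qed.

Local Notation sum2 f := (\sum_(i < n) \sum_(j < n) f i j).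
Local Notation sum3 f := (\sum_(i < n) sum2 (f i)).
Local Notation sum4 f := (\sum_(i < n) sum3 (f i)).

Lemma sum3_swap23 (f : 'I_n -> 'I_n -> 'I_n -> R) :
  sum3 f = sum3 (fun i j k => f i k j).
Proof. by apply: eq_bigr => i _; rewrite exchange_big. Qed.

Lemma sum4_swap23 (f : 'I_n -> 'I_n -> 'I_n -> 'I_n -> R) :
  sum4 f = sum4 (fun i j k l => f i k j l).
Proof. by apply: eq_bigr => i _; rewrite exchange_big. Qed.

Lemma sum4_swap34 (f : 'I_n -> 'I_n -> 'I_n -> 'I_n -> R) :
  sum4 f = sum4 (fun i j k l => f i j l k).
Proof. by apply: eq_bigr => i _; exact: sum3_swap23. Qed.

Lemma sum3_swap12 (f : 'I_n -> 'I_n -> 'I_n -> R) :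
  sum3 f = sum3 (fun i j k => f j i k).
Proof. by rewrite exchange_big. Qed.

Lemma sum4_swap12 (f : 'I_n -> 'I_n -> 'I_n -> 'I_n -> R) :
  sum4 f = sum4 (fun i j k l => f j i k l).
Proof. by rewrite exchange_big. Qed.

Lemma sum2_trace (T : 'I_n -> 'I_n -> R) :
  sum2 (fun i j => 'd_(i, j) * T i j) = \sum_i T i i.
Proof.
apply: eq_bigr => i _; rewrite -[RHS](sum_delta i (T i)).
by apply: eq_bigr => j _; rewrite delta_sym.
Qed.

(** Tracelessness makes [T] orthogonal to every tensor carrying a delta in its first two indices;
    the correction terms of harmonic tensors drop out this way. *)
Lemma traceless3 (T : 'I_n -> 'I_n -> 'I_n -> R) w :
  (forall k, \sum_i T i i k = 0) ->
  sum3 (fun i j k => T i j k * ('d_(i, j) * w k)) = 0.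
Proof.
move=> T0.
rewrite sum3_swap23 exchange_big big1 //= => k _.
transitivity (w k * sum2 (fun i j => 'd_(i, j) * T i j k)).
  rewrite mulr_sumr; apply: eq_bigr => i _.
  by rewrite mulr_sumr; apply: eq_bigr => j _; ring.
by rewrite (sum2_trace (fun i j => T i j k)) T0 mulr0.
Qed.

Lemma traceless4 (T : 'I_n -> 'I_n -> 'I_n -> 'I_n -> R) w :
  (forall k l, \sum_i T i i k l = 0) ->
  sum4 (fun i j k l => T i j k l * ('d_(i, j) * w k l)) = 0.
Proof.
move=> T0.
rewrite sum4_swap34 sum4_swap23 exchange_big big1 //= => l _.
exact: (@traceless3 (fun i j k => T i j k l) (fun k => w k l)).
Qed.

Lemma coord_dot u v (x : R) : \sum_i x * (u 0 i * v 0 i) = x * dot u v.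
Proof. by rewrite -mulr_sumr. Qed.

(** For unit [u], the traceless part of its tensor square, scaled by [n] to clear denominators. The
    factors for the cube and the fourth power below are [n + 2] and [(n + 2) (n + 4)]. *)
Definition tensor2 u (i j : 'I_n) : R := n%:R * (u 0 i * u 0 j) - 'd_(i, j).

(** Only the tensor of [v] is expanded: its delta terms vanish against the traceless tensor of [u],
    leaving a contraction with a power of [v]. Degrees 3 and 4 follow the same pattern. *)
Lemma tensor2_dot u v : dot u u = 1 -> dot v v = 1 ->
  sum2 (fun i j => tensor2 u i j * tensor2 v i j) =
  n%:R * (n%:R * dot u v ^+ 2 - 1).
Proof.
move=> u1 v1.
have trace : \sum_i tensor2 u i i = 0.
  by rewrite /tensor2 sumrB coord_dot sum_delta_diag u1 mulr1 subrr.
transitivity (n%:R * sum2 (fun i j => tensor2 u i j * (v 0 i * v 0 j))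
  - sum2 (fun i j => 'd_(i, j) * tensor2 u i j)).
  rewrite mulr_sumr -sumrB; apply: eq_bigr => i _.
  rewrite mulr_sumr -sumrB; apply: eq_bigr => j _.
  by rewrite {2}/tensor2; ring.
rewrite sum2_trace trace subr0; congr (_ * _).
transitivity (sum2 (fun i j => n%:R * (u 0 i * v 0 i) * (u 0 j * v 0 j))
  - sum2 (fun i j => 'd_(i, j) * (v 0 i * v 0 j))).
  rewrite -sumrB; apply: eq_bigr => i _.
  by rewrite -sumrB; apply: eq_bigr => j _; rewrite /tensor2; ring.
rewrite sum2_trace -/(dot v v) v1 (eq_bigr _ (fun i _ => coord_dot _ _ _)).
by rewrite -mulr_suml coord_dot -mulrA expr2.
Qed.

Definition tensor3 u (i j k : 'I_n) : R :=
  (n%:R + 2) * (u 0 i * u 0 j * u 0 k)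
  - ('d_(i, j) * u 0 k + 'd_(i, k) * u 0 j + 'd_(j, k) * u 0 i).

Lemma tensor3_swap12 u i j k : tensor3 u i j k = tensor3 u j i k.
Proof. by rewrite /tensor3 (delta_sym i j); ring. Qed.

Lemma tensor3_swap23 u i j k : tensor3 u i j k = tensor3 u i k j.
Proof. by rewrite /tensor3 (delta_sym j k); ring. Qed.

Lemma tensor3_trace u k : dot u u = 1 -> \sum_i tensor3 u i i k = 0.
Proof.
move=> u1; rewrite /tensor3 sumrB -mulr_sumr -mulr_suml -/(dot u u) u1.
rewrite !big_split /= -mulr_suml sum_delta_diag.
by rewrite !(sum_delta k (fun i => u 0 i)); ring.
Qed.

Lemma tensor3_dot u v : dot u u = 1 -> dot v v = 1 ->
  sum3 (fun i j k => tensor3 u i j k * tensor3 v i j k) =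
  (n%:R + 2) * ((n%:R + 2) * dot u v ^+ 3 - 3 * dot u v).
Proof.
move=> u1 v1.
pose V i j k : R := 'd_(i, j) * v 0 k.
have trace0 : sum3 (fun i j k => tensor3 u i j k * V i j k) = 0.
  by apply: traceless3 => k; exact: tensor3_trace.
have trace1 : sum3 (fun i j k => tensor3 u i j k * V i k j) = 0.
  rewrite -[RHS]trace0 sum3_swap23; do 3![apply: eq_bigr => ? _].
  by rewrite tensor3_swap23.
have trace2 : sum3 (fun i j k => tensor3 u i j k * V j k i) = 0.
  rewrite -[RHS]trace1 sum3_swap12; do 3![apply: eq_bigr => ? _].
  by rewrite tensor3_swap12.
transitivity ((n%:R + 2) *
  sum3 (fun i j k => tensor3 u i j k * (v 0 i * v 0 j * v 0 k))
  - (sum3 (fun i j k => tensor3 u i j k * V i j k)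
     + sum3 (fun i j k => tensor3 u i j k * V i k j)
     + sum3 (fun i j k => tensor3 u i j k * V j k i))).
  rewrite mulr_sumr -!big_split -sumrB; apply: eq_bigr => i _.
  rewrite mulr_sumr -!big_split -sumrB; apply: eq_bigr => j _.
  rewrite mulr_sumr -!big_split -sumrB; apply: eq_bigr => k _.
  by rewrite /V {2}/tensor3 /=; ring.
rewrite trace0 trace1 trace2 !addr0 subr0; congr (_ * _).
have contr i j : \sum_k tensor3 u i j k * (v 0 i * v 0 j * v 0 k) =
  (n%:R + 2) * dot u v * (u 0 i * v 0 i) * (u 0 j * v 0 j)
  - dot u v * ('d_(i, j) * (v 0 i * v 0 j))
  - (u 0 j * v 0 j) * (v 0 i * v 0 i) - (v 0 j * v 0 j) * (u 0 i * v 0 i).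
  transitivity (\sum_k ((n%:R + 2) * (u 0 i * v 0 i) * (u 0 j * v 0 j) * (u 0 k * v 0 k)
     - ('d_(i, j) * (v 0 i * v 0 j)) * (u 0 k * v 0 k)
     - 'd_(k, i) * ((u 0 j * v 0 j) * (v 0 i * v 0 k))
     - 'd_(k, j) * ((v 0 j * v 0 k) * (u 0 i * v 0 i)))).
    apply: eq_bigr => k _.
    by rewrite /tensor3 (delta_sym k i) (delta_sym k j); ring.
  rewrite !sumrB !coord_dot !sum_delta; ring.
under eq_bigr => i _ do rewrite (eq_bigr _ (fun j _ => contr i j)).
under eq_bigr => i _ do rewrite !sumrB coord_dot -!mulr_sumr -!mulr_suml -/(dot v v) -/(dot u v) v1.
rewrite !sumrB.
rewrite -(mulr_suml _ _ _ (dot u v)) coord_dot -!mulr_sumr sum2_trace -!/(dot _ _) v1.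
rewrite -?mulr_sumr -!/(dot _ _); ring.
Qed.

Definition tensor4 u (i j k l : 'I_n) : R :=
  (n%:R + 2) * (n%:R + 4) * (u 0 i * u 0 j * u 0 k * u 0 l)
  - (n%:R + 2) *
    ('d_(i, j) * (u 0 k * u 0 l) + 'd_(i, k) * (u 0 j * u 0 l)
     + 'd_(i, l) * (u 0 j * u 0 k) + 'd_(j, k) * (u 0 i * u 0 l)
     + 'd_(j, l) * (u 0 i * u 0 k) + 'd_(k, l) * (u 0 i * u 0 j))
  + ('d_(i, j) * 'd_(k, l) + 'd_(i, k) * 'd_(j, l) + 'd_(i, l) * 'd_(j, k)).

Lemma tensor4_swap12 u i j k l : tensor4 u i j k l = tensor4 u j i k l.
Proof. by rewrite /tensor4 (delta_sym i j); ring. Qed.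

Lemma tensor4_swap23 u i j k l : tensor4 u i j k l = tensor4 u i k j l.
Proof. by rewrite /tensor4 (delta_sym j k); ring. Qed.

Lemma tensor4_swap34 u i j k l : tensor4 u i j k l = tensor4 u i j l k.
Proof. by rewrite /tensor4 (delta_sym k l); ring. Qed.

Lemma tensor4_trace u k l : dot u u = 1 -> \sum_i tensor4 u i i k l = 0.
Proof.
move=> u1; pose c : R := n%:R + 2.
transitivity (\sum_i (c * (n%:R + 4) * (u 0 k * u 0 l) * (u 0 i * u 0 i)
  + ('d_(k, l) - c * (u 0 k * u 0 l)) * 'd_(i, i)
  - c * 'd_(k, l) * (u 0 i * u 0 i)
  + 'd_(i, k) * (2 * 'd_(i, l) - 2 * c * (u 0 i * u 0 l))
  - 'd_(i, l) * (2 * c * (u 0 i * u 0 k)))).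
  by apply: eq_bigr => i _; rewrite /tensor4 /c; ring.
rewrite !(sumrB, big_split) /= !coord_dot -!mulr_sumr sum_delta_diag !sum_delta.
by rewrite u1 /c; ring.
Qed.

Lemma sum4_factor (w : 'I_n -> 'I_n -> R) (x y : 'I_n -> R) :
  sum4 (fun i j k l => w i j * x k * y l) =
  sum2 w * (\sum_i x i) * (\sum_i y i).
Proof.
rewrite -mulrA mulr_suml; apply: eq_bigr => i _.
rewrite mulr_suml; apply: eq_bigr => j _.
rewrite mulr_suml mulr_sumr; apply: eq_bigr => k _.
by rewrite mulrA mulr_sumr.
Qed.

Lemma tensor4_dot u v : dot u u = 1 -> dot v v = 1 ->
  sum4 (fun i j k l => tensor4 u i j k l * tensor4 v i j k l) =
  (n%:R + 2) * (n%:R + 4) *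
  ((n%:R + 2) * (n%:R + 4) * dot u v ^+ 4 - 6 * (n%:R + 2) * dot u v ^+ 2 + 3).
Proof.
move=> u1 v1; pose c : R := n%:R + 2.
pose T := tensor4 u.
(* Each product of two deltas is shared equally between its two factors, so that six permuted copies
   of [V] make up all correction terms. *)
pose V i j k l : R := 'd_(i, j) * (c * (v 0 k * v 0 l) - 'd_(k, l) / 2).
have V12 : sum4 (fun i j k l => T i j k l * V i j k l) = 0.
  apply: (@traceless4 T (fun k l => c * (v 0 k * v 0 l) - 'd_(k, l) / 2)).
  by move=> k l; exact: tensor4_trace.
have V13 : sum4 (fun i j k l => T i j k l * V i k j l) = 0.
  rewrite -[RHS]V12 sum4_swap23; do 4![apply: eq_bigr => ? _].
  by rewrite /T tensor4_swap23.
have V14 : sum4 (fun i j k l => T i j k l * V i l j k) = 0.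
  rewrite -[RHS]V13 sum4_swap34; do 4![apply: eq_bigr => ? _].
  by rewrite /T tensor4_swap34.
have V23 : sum4 (fun i j k l => T i j k l * V j k i l) = 0.
  rewrite -[RHS]V13 sum4_swap12; do 4![apply: eq_bigr => ? _].
  by rewrite /T tensor4_swap12.
have V24 : sum4 (fun i j k l => T i j k l * V j l i k) = 0.
  rewrite -[RHS]V23 sum4_swap34; do 4![apply: eq_bigr => ? _].
  by rewrite /T tensor4_swap34.
have V34 : sum4 (fun i j k l => T i j k l * V k l i j) = 0.
  rewrite -[RHS]V24 sum4_swap23; do 4![apply: eq_bigr => ? _].
  by rewrite /T tensor4_swap23.
transitivity (c * (n%:R + 4) *
  sum4 (fun i j k l => T i j k l * (v 0 i * v 0 j * v 0 k * v 0 l))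
  - (sum4 (fun i j k l => T i j k l * V i j k l)
     + sum4 (fun i j k l => T i j k l * V i k j l)
     + sum4 (fun i j k l => T i j k l * V i l j k)
     + sum4 (fun i j k l => T i j k l * V j k i l)
     + sum4 (fun i j k l => T i j k l * V j l i k)
     + sum4 (fun i j k l => T i j k l * V k l i j))).
  do 4![rewrite mulr_sumr -!big_split -sumrB; apply: eq_bigr => ? _].
  by rewrite /V /T {2}/tensor4 /c /=; field.
rewrite V12 V13 V14 V23 V24 V34 !addr0 subr0 -/c; congr (_ * _).
(* Terms with no, one and two deltas; they contribute the powers 4, 2 and 0 of [dot u v]. *)
pose A i j k l : R := (u 0 i * v 0 i) * (u 0 j * v 0 j) * (u 0 k * v 0 k) * (u 0 l * v 0 l).
pose B i j k l : R := 'd_(i, j) * (v 0 i * v 0 j) * (u 0 k * v 0 k) * (u 0 l * v 0 l).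
pose C i j k l : R := 'd_(i, j) * (v 0 i * v 0 j) * ('d_(k, l) * (v 0 k * v 0 l)).
have A0 : sum4 A = dot u v ^+ 4.
  rewrite (sum4_factor (fun i j => (u 0 i * v 0 i) * (u 0 j * v 0 j))).
  under eq_bigr => i _ do rewrite coord_dot.
  by rewrite -mulr_suml -!/(dot u v); ring.
have B12 : sum4 B = dot u v ^+ 2.
  rewrite (sum4_factor (fun i j => 'd_(i, j) * (v 0 i * v 0 j))).
  by rewrite sum2_trace -!/(dot _ _) v1 mul1r expr2.
have B13 : sum4 (fun i j k l => B i k j l) = dot u v ^+ 2.
  by rewrite -B12 sum4_swap23.
have B14 : sum4 (fun i j k l => B i l j k) = dot u v ^+ 2.
  by rewrite -B13 sum4_swap34.
have B23 : sum4 (fun i j k l => B j k i l) = dot u v ^+ 2.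
  by rewrite -B13 sum4_swap12.
have B24 : sum4 (fun i j k l => B j l i k) = dot u v ^+ 2.
  by rewrite -B23 sum4_swap34.
have B34 : sum4 (fun i j k l => B k l i j) = dot u v ^+ 2.
  by rewrite -B24 sum4_swap23.
have C12 : sum4 C = 1.
  transitivity (sum2 (fun i j => 'd_(i, j) * (v 0 i * v 0 j)) ^+ 2).
    rewrite expr2 mulr_suml; apply: eq_bigr => i _.
    rewrite mulr_suml; apply: eq_bigr => j _.
    rewrite mulr_sumr; apply: eq_bigr => k _.
    by rewrite mulr_sumr.
  by rewrite sum2_trace -/(dot v v) v1 expr1n.
have C13 : sum4 (fun i j k l => C i k j l) = 1 by rewrite -C12 sum4_swap23.
have C14 : sum4 (fun i j k l => C i l j k) = 1 by rewrite -C13 sum4_swap34.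
transitivity (c * (n%:R + 4) * sum4 A
  - c * (sum4 B + sum4 (fun i j k l => B i k j l)
     + sum4 (fun i j k l => B i l j k) + sum4 (fun i j k l => B j k i l)
     + sum4 (fun i j k l => B j l i k) + sum4 (fun i j k l => B k l i j))
  + (sum4 C + sum4 (fun i j k l => C i k j l) + sum4 (fun i j k l => C i l j k))).
  do 4![rewrite !mulr_sumr -!big_split !mulr_sumr -sumrB -big_split;
        apply: eq_bigr => ? _].
  by rewrite /A /B /C /T /tensor4 /c /=; ring.
by rewrite A0 B12 B13 B14 B23 B24 B34 C12 C13 C14; ring.
Qed.
End Harmonic.

Lemma left_null_vector (F : fieldType) p q (A : 'M[F]_(p, q)) :
  (q < p)%N -> exists2 v : 'rV_p, v != 0 & v *m A = 0.
Proof.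
move=> qp; have : kermx A != 0.
  by rewrite -mxrank_eq0 mxrank_ker subn_eq0 -ltnNge (leq_ltn_trans (rank_leq_col A)).
by case/rowV0Pn => v /sub_kermxP vA v0; exists v.
Qed.

(** These pairs index the entries on or below the diagonal, hence the coordinates of a symmetric
    matrix. *)
Lemma card_lower_triangle n :
  #|{: {i : 'I_n & 'I_i.+1}}| = (n * n.+1 %/ 2)%N.
Proof.
rewrite card_tagged sumnE big_map big_enum /=.
under eq_bigr => i _ do rewrite card_ord.
suff <- : (\sum_(i < n) i.+1 * 2 = n * n.+1)%N by rewrite -big_distrl mulnK.
by elim: n => [|n IHn]; rewrite ?big_ord0 // big_ord_recr /= IHn; lia.
Qed.

(** * Inequalities for families of unit vectors, and the case of nonnegative a + b *)

Section Family.
Variables (R : realType) (n N : nat) (X : 'I_N -> 'rV[R]_n).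
Hypothesis X1 : forall i, dot (X i) (X i) = 1.

(** Gegenbauer polynomials for the sphere of [R^n], up to a positive factor; degrees above 4 default
    to the constant 1. *)
Definition zonal (d : nat) (t : R) : R :=
  match d with
  | 1 => t
  | 2 => n%:R * t ^+ 2 - 1
  | 3 => (n%:R + 2) * t ^+ 3 - 3 * t
  | 4 => (n%:R + 2) * (n%:R + 4) * t ^+ 4 - 6 * (n%:R + 2) * t ^+ 2 + 3
  | _ => 1
  end.

Lemma feature_ge0 (f : 'I_N -> R) : 0 <= \sum_i \sum_j f i * f j.
Proof.
under eq_bigr => i _ do rewrite -mulr_sumr.
by rewrite -mulr_suml -expr2 sqr_ge0.
Qed.

Lemma feature_sum_ge0 (I : finType) (F : 'I_N -> 'I_N -> I -> R) :
  (forall k, 0 <= \sum_i \sum_j F i j k) ->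
  0 <= \sum_i \sum_j \sum_k F i j k.
Proof.
move=> F0; under eq_bigr => i _ do rewrite exchange_big /=.
by rewrite exchange_big sumr_ge0.
Qed.

(** Up to a positive factor, the summand is an inner product of harmonic tensors, so the double sum
    is a sum, over tensor entries, of squares. *)
Lemma zonal_sum_ge0 d : (0 < n)%N ->
  0 <= \sum_i \sum_j zonal d (dot (X i) (X j)).
Proof.
move=> n0; have n0R : 0 < n%:R :> R by rewrite ltr0n.
have scale (c : R) (f g : R -> R) : 0 < c ->
    (forall i j, f (dot (X i) (X j)) = c * g (dot (X i) (X j))) ->
    0 <= \sum_i \sum_j f (dot (X i) (X j)) ->
    0 <= \sum_i \sum_j g (dot (X i) (X j)).
  move=> c0 fg; rewrite (_ : \sum_i _ = c * \sum_i \sum_j g (dot (X i) (X j))).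
    by rewrite pmulr_rge0.
  rewrite mulr_sumr; apply: eq_bigr => i _.
  by rewrite mulr_sumr; apply: eq_bigr => j _.
case: d => [|[|[|[|[|d]]]]] /=; try by do 2![apply: sumr_ge0 => ? _].
- by do 1![apply: feature_sum_ge0 => ?]; exact: (feature_ge0 (fun i => X i 0 _)).
- apply: (scale n%:R (fun t => n%:R * (n%:R * t ^+ 2 - 1)) (zonal 2)) => //.
  under eq_bigr => i _ do
    rewrite (eq_bigr _ (fun j _ => esym (tensor2_dot (X1 i) (X1 j)))).
  by do 2![apply: feature_sum_ge0 => ?]; exact: (feature_ge0 (fun i => tensor2 _ _ _)).
- apply: (scale (n%:R + 2) (fun t => (n%:R + 2) * ((n%:R + 2) * t ^+ 3 - 3 * t)) (zonal 3)).
  + by rewrite addr_gt0.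
  + by [].
  under eq_bigr => i _ do
    rewrite (eq_bigr _ (fun j _ => esym (tensor3_dot (X1 i) (X1 j)))).
  by do 3![apply: feature_sum_ge0 => ?]; exact: (feature_ge0 (fun i => tensor3 _ _ _ _)).
apply: (scale ((n%:R + 2) * (n%:R + 4)) (fun t => (n%:R + 2) * (n%:R + 4) *
  ((n%:R + 2) * (n%:R + 4) * t ^+ 4 - 6 * (n%:R + 2) * t ^+ 2 + 3)) (zonal 4)).
- by rewrite mulr_gt0 ?addr_gt0.
- by [].
under eq_bigr => i _ do
  rewrite (eq_bigr _ (fun j _ => esym (tensor4_dot (X1 i) (X1 j)))).
by do 4![apply: feature_sum_ge0 => ?]; exact: (feature_ge0 (fun i => tensor4 _ _ _ _ _)).
Qed.

Variables a b : R.
Hypothesis Xab : forall i j, i != j -> dot (X i) (X j) = a \/ dot (X i) (X j) = b.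

Lemma pair_counts : exists p q : nat, (p + q = N * N.-1)%N /\
  forall f : R -> R, \sum_i \sum_j f (dot (X i) (X j)) =
    N%:R * f 1 + p%:R * f a + q%:R * f b.
Proof.
pose off := [pred ij : 'I_N * 'I_N | ij.1 != ij.2].
pose at_a := [pred ij : 'I_N * 'I_N | dot (X ij.1) (X ij.2) == a].
have diag (f : 'I_N * 'I_N -> R) : \sum_(ij | ~~ off ij) f ij = \sum_i f (i, i).
  rewrite (reindex (fun i => (i, i))) /=; first by apply: eq_bigl => i; rewrite eqxx.
  by exists fst => [i|[i j]] //=; rewrite !inE /= negbK => /eqP ->.
(* Ordered pairs are counted; if [a = b], all of them go to the first number. *)
exists #|[predI off & at_a]|, #|[predD off & at_a]|; split.
  have := cardC off; rewrite cardID card_prod !card_ord.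
  have -> : #|[predC off]| = N.
    rewrite -sum1_card (reindex (fun i : 'I_N => (i, i))) /=.
      rewrite (eq_bigl predT) ?sum1_card ?card_ord // => i.
      by rewrite !inE eqxx.
    by exists fst => [i|[i j]] //=; rewrite !inE /= negbK => /eqP ->.
  by move: #|off| => x; case: (N) => [|m] /=; nia.
move=> f; rewrite pair_big /= (bigID off) /= addrC diag /=.
rewrite (eq_bigr (fun=> f 1)) => [|i _]; last by rewrite X1.
rewrite sumr_const card_ord mulr_natl -addrA; congr (_ + _).
rewrite (bigID at_a) /=; congr (_ + _).
  rewrite (eq_bigr (fun=> f a)) => [|[i j] /andP[_ /eqP -> //]].
  by rewrite sumr_const mulr_natl; congr (_ *+ _); apply: eq_card.
rewrite (eq_bigr (fun=> f b)) => [|[i j] /= /andP[/Xab[-> | -> //]]]; last first.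
  by rewrite eqxx.
rewrite sumr_const mulr_natl; congr (_ *+ _); apply: eq_card => -[i j].
by rewrite !inE andbC.
Qed.

(* With [t := dot u v], [t ^+ 2 + a * b = (a + b) * t] off the diagonal, so the
   values of the quadratic forms [u^T u + a b I] at the vectors [v] make up the
   matrix [(a + b) G + (1 - a)(1 - b) I], where [G] is the Gram matrix. *)
Lemma bound_of_nonneg_sum : a < 1 -> b < 1 -> 0 <= a + b ->
  (N <= n * n.+1 %/ 2)%N.
Proof.
move=> a1 b1 ab0; rewrite leqNgt -card_lower_triangle; apply/negP => N_gt.
pose K := {i : 'I_n & 'I_i.+1}.
pose col (k : K) : 'I_n := widen_ord (ltn_ord (tag k)) (tagged k).
(* One row per vector and one column per triangle entry: with more rows than columns, some nonzero
   combination [c] of the symmetric matrices vanishes. *)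
pose Phi := \matrix_(u < N, k < #|{: K}|)
  (X u 0 (tag (enum_val k)) * X u 0 (col (enum_val k))
   + a * b * (tag (enum_val k) == col (enum_val k))%:R).
have [c c0 cPhi] := left_null_vector Phi N_gt.
have rel_le (i j : 'I_n) : (j <= i)%N ->
    \sum_u c 0 u * (X u 0 i * X u 0 j + a * b * (i == j)%:R) = 0.
  move=> ji; have /rowP/(_ (enum_rank (Tagged _ (Ordinal (ji : (j < i.+1)%N))))) := cPhi.
  rewrite !mxE => h; rewrite -[RHS]h; apply: eq_bigr => u _; rewrite mxE enum_rankK /=.
  by rewrite (_ : col _ = j) //; apply: val_inj.
have rel (i j : 'I_n) :
    \sum_u c 0 u * (X u 0 i * X u 0 j + a * b * (i == j)%:R) = 0.
  case: (leqP j i) => [|/ltnW] ji; first exact: rel_le.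
  rewrite -[RHS](rel_le _ _ ji); apply: eq_bigr => u _.
  by rewrite eq_sym (mulrC (X u 0 i)).
have quad v : \sum_u c 0 u * (dot (X u) (X v) ^+ 2 + a * b) = 0.
  transitivity (\sum_i \sum_j X v 0 i * X v 0 j *
      \sum_u c 0 u * (X u 0 i * X u 0 j + a * b * (i == j)%:R)); last first.
    by rewrite big1 // => i _; rewrite big1 // => j _; rewrite rel mulr0.
  under [RHS]eq_bigr => i _ do
    (under eq_bigr => j _ do rewrite mulr_sumr; rewrite exchange_big /=).
  rewrite exchange_big /=; apply: eq_bigr => u _.
  rewrite [in LHS](_ : a * b =
      a * b * \sum_i \sum_j (i == j)%:R * (X v 0 i * X v 0 j)); last first.
    by rewrite sum2_trace -/(dot _ _) X1 mulr1.
  rewrite expr2 {1}/dot mulr_suml [a * b * _]mulr_sumr -big_split mulr_sumr.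
  apply: eq_bigr => i _ /=.
  rewrite /dot !mulr_sumr -big_split mulr_sumr; apply: eq_bigr => j _ /=.
  ring.
pose s := \sum_u c 0 u *: X u.
have lin v : (a + b) * dot s (X v) + (1 - a) * (1 - b) * c 0 v = 0.
  rewrite -[RHS](quad v) (_ : dot s _ = \sum_u c 0 u * dot (X u) (X v)).
    rewrite (bigD1 v) //= [in RHS](bigD1 v) //= X1 mulrDr mulr_sumr addrAC.
    congr (_ + _); first by ring.
    apply: eq_bigr => u uv; case: (Xab uv) => ->; ring.
  under [RHS]eq_bigr => u _ do rewrite mulr_sumr.
  rewrite exchange_big /=; apply: eq_bigr => i _.
  by rewrite summxE mulr_suml; apply: eq_bigr => u _; rewrite mxE mulrA.
(* Pairing [lin] with [c] gives a vanishing sum of two nonnegative terms, which forces [c = 0]. *)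
have : (a + b) * dot s s + (1 - a) * (1 - b) * dot c c = 0.
  have -> : dot s s = \sum_v c 0 v * dot s (X v).
    under [RHS]eq_bigr => u _ do rewrite mulr_sumr.
    rewrite exchange_big /=; apply: eq_bigr => i _.
    rewrite {2}/s summxE mulr_sumr; apply: eq_bigr => u _; rewrite mxE; ring.
  rewrite !mulr_sumr -big_split big1 //= => v _.
  by rewrite -[RHS](mulr0 (c 0 v)) -(lin v); ring.
have dot_ge0 m (w : 'rV[R]_m) : 0 <= dot w w.
  by apply: sumr_ge0 => i _; rewrite -expr2 sqr_ge0.
move/eqP; rewrite paddr_eq0 ?mulr_ge0 ?subr_ge0 ?(ltW a1) ?(ltW b1) //.
case/andP => _; rewrite !mulf_eq0 !subr_eq0 !(gt_eqF a1, gt_eqF b1) /=.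
apply/negP; rewrite psumr_eq0 => [|i _]; last by rewrite -expr2 sqr_ge0.
apply: contra c0 => /allP c0; apply/eqP/rowP => i; rewrite mxE; apply/eqP.
by have := c0 i (mem_index_enum _); rewrite -expr2 sqrf_eq0.
Qed.
End Family.

(** * The Larman-Rogers-Seidel theorem *)

(* Discarding the rows outside a basis [f] of the row space of [V], the rational
   system [z A_f + t 1_f = 0] has more unknowns than equations, and multiplying
   it by [V] gives [theta z + t = 0]. *)
Lemma eigenvalue_rational (R : realType) N m (A : 'M[rat]_N) (theta : R)
    (V : 'M[R]_(N, m)) :
  map_mx ratr A *m V = theta *: V -> (N < \rank V + \rank V)%N ->
  exists q : rat, theta = ratr q.
Proof.
move=> AV rkV; set f := maxrankfun V.
have [v v0 vM] := left_null_vector (col_mx (rowsub f A) (rowsub f 1%:M)) rkV.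
set z := lsubmx v; set t := rsubmx v.
have zt : theta *: map_mx ratr z + map_mx ratr t = 0.
  apply/eqP; rewrite -(mulmx_free_eq0 _ (maxrowsub_free V)) -/f; apply/eqP.
  have := congr1 (fun M => map_mx ratr M *m V) vM.
  rewrite /= -[v]hsubmxK mul_row_col map_mxD !map_mxM !map_mxsub map_mx1.
  rewrite map_mx0 mul0mx mulmxDl -!mulmxA !mul_rowsub_mx AV mul1mx => <-.
  rewrite mulmxDl -scalemxAl; congr (_ + _).
  rewrite scalemxAr; congr (_ *m _).
  by apply/matrixP => i j; rewrite !mxE.
have [i zi] : exists i, z 0 i != 0.
  apply/rV0Pn; apply: contra_neq v0 => z0.
  have t0 : t = 0.
    apply/rowP => i; apply: (fmorph_inj (@ratr R)).
    have /rowP/(_ i) := zt; rewrite z0 map_mx0 scaler0 add0r !mxE => ti.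
    by rewrite rmorph0; exact: ti.
  by rewrite -[v]hsubmxK -/z -/t z0 t0 row_mx0.
exists (- t 0 i / z 0 i); rewrite fmorph_div rmorphN.
apply: (canRL (mulfK _)); first by rewrite fmorph_eq0.
by have /rowP/(_ i) := zt; rewrite !mxE => /eqP; rewrite addr_eq0 => /eqP.
Qed.

(** After clearing denominators, reduce modulo a prime [l] dividing the denominator: the matrix
    becomes the scalar [- p], so [l] also divides the numerator. *)
Lemma rational_eigenvalue_int N (A : 'M[int]_N) (theta : rat) :
  \det (map_mx intr A - theta%:M) = 0 -> exists k : int, theta = k%:~R.
Proof.
move=> detA; set p := numq theta; set q := denq theta.
have detZ : \det (q *: A - p%:M) = 0.
  apply: (intr_inj (R := rat)).
  rewrite -det_map_mx map_mxB map_mxZ map_scalar_mx /=.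
  rewrite (_ : p%:~R%:M = q%:~R *: theta%:M); last first.
    by rewrite scale_scalar_mx; rewrite mulrC; congr _%:M; exact: numqE.
  by rewrite -scalerBr detZ detA mulr0.
have q_gt0 : (0 < `|q|)%N by rewrite absz_gt0 denq_neq0.
have [q1|q_gt1] := leqP `|q| 1.
  exists p; rewrite /p numqE -/q; suff -> : q = 1 by rewrite mulr1.
  by have := denq_gt0 theta; rewrite -/q; lia.
have l_prime := pdiv_prime q_gt1; set l := pdiv `|q| in l_prime.
have dvdE (x : int) : (x%:~R == 0 :> 'F_l) = (l %| `|x|)%N.
  rewrite (dvdn_pcharf (pchar_Fp l_prime)).
  by case: x => x //; rewrite NegzE rmorphN oppr_eq0 abszN.
have : (\det (q *: A - p%:M))%:~R == 0 :> 'F_l by rewrite detZ.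
rewrite -det_map_mx map_mxB map_mxZ map_scalar_mx /=.
have /eqP -> : q%:~R == 0 :> 'F_l by rewrite dvdE pdiv_dvd.
rewrite scale0r sub0r -scaleN1r scale_scalar_mx mulN1r det_scalar.
rewrite expf_eq0 oppr_eq0 dvdE => /andP[_ lp].
have := coprime_num_den theta; rewrite /coprime => /eqP g1.
have : (l %| gcdn `|p| `|q|)%N by rewrite dvdn_gcd lp pdiv_dvd.
by rewrite g1 dvdn1 => /eqP l1; rewrite l1 in l_prime.
Qed.

Section LarmanRogersSeidel.
Variables (R : realType) (n N : nat) (X : 'I_N -> 'rV[R]_n) (a b : R).
Hypothesis X1 : forall i, dot (X i) (X i) = 1.
Hypothesis Xab : forall i j, i != j -> dot (X i) (X j) = a \/ dot (X i) (X j) = b.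
Hypotheses (ba : b < a) (a1 : a < 1).

(* The Gram matrix is [(1 - b) I + (a - b) A + b J] with [A] the adjacency
   matrix of the pairs at inner product [a]; so [A + ((1 - b) / (a - b)) I] has
   rank at most [n + 1]. *)
Lemma ratio_int : (n.*2.+2 < N)%N ->
  exists2 k : nat, (1 < k)%N & 1 - b = k%:R * (a - b).
Proof.
move=> nN; have ab0 : 0 < a - b by rewrite subr_gt0.
pose A : 'M[int]_N := \matrix_(i, j) ((i != j) && (dot (X i) (X j) == a))%:R.
pose theta := - ((1 - b) / (a - b)).
pose M : 'M[R]_N := map_mx intr A - theta%:M.
have rkM : (\rank M <= n.+1)%N.
  pose B := row_mx (\matrix_i X i) (const_mx 1 : 'cV[R]_N).
  pose C := col_mx (\matrix_i X i)^T (const_mx (- b) : 'rV[R]_N).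
  have -> : M = (a - b)^-1 *: (B *m C).
    apply: (canRL (scalerK _)); first by rewrite gt_eqF.
    apply/matrixP => i j; rewrite /B /C mul_row_col !mxE big_ord1 !mxE mul1r.
    rewrite (_ : \sum_k _ = dot (X i) (X j)); last first.
      by apply: eq_bigr => k _; rewrite !mxE.
    have [<-|ij] := eqVneq i j.
      by rewrite X1 /theta /=; field; rewrite gt_eqF.
    rewrite /= mulr0n subr0; case: (eqVneq _ a) => [->|dij].
      by rewrite mulr1.
    have [/eqP|->] := Xab ij; first by rewrite (negPf dij).
    by rewrite mulr0 subrr.
  rewrite mxrank_scale_nz ?invr_eq0 ?gt_eqF //.
  by rewrite (leq_trans (mulmx_max_rank B C)) ?addn1.
have detM : \det M = 0.
  apply/eqP; rewrite -[_ == _]negbK -unitfE -unitmxE -row_free_unit.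
  by rewrite /row_free neq_ltn (leq_ltn_trans rkM) //; lia.
(* The columns of [cokermx M] span the eigenspace of [theta], of dimension at least [N - n - 1],
   which exceeds [N / 2]. *)
have [q thetaE] : exists q : rat, theta = ratr q.
  apply: (@eigenvalue_rational _ _ _ (map_mx intr A) _ (cokermx M)).
    have := mulmx_coker M; rewrite {1}/M mulmxBl mul_scalar_mx => /eqP.
    rewrite subr_eq0 => /eqP <-; congr (_ *m _).
    by apply/matrixP => i j; rewrite !mxE ratr_int.
  by rewrite mxrank_coker; lia.
have [k qE] : exists k : int, q = k%:~R.
  apply: (@rational_eigenvalue_int _ A); apply: (fmorph_inj (@ratr R)).
  rewrite rmorph0 -detM -det_map_mx map_mxB map_scalar_mx /=.
  congr (\det (_ - _)); last by rewrite /= thetaE.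
  by apply/matrixP => i j; rewrite !mxE ratr_int.
have kE : (1 - b) / (a - b) = (- k)%:~R.
  by rewrite rmorphN -[LHS]opprK -/theta thetaE qE ratr_int.
have k_gt1 : 1 < - k.
  by rewrite -(ltr_int R) -kE ltr_pdivlMr // mul1r ltrD2r.
case: k kE k_gt1 {qE} => k; rewrite ?NegzE ?opprK => kE k_gt1; first by lia.
by exists k.+1 => //; rewrite -[LHS](divfK (lt0r_neq0 ab0)) kE.
Qed.

(* With [k = (1 - b) / (a - b)] the Gram matrix becomes, after adding one
   constant coordinate and rescaling, that of unit vectors of [R^(n+1)] with
   inner products [1 / (2 k - 1)] and [- 1 / (2 k - 1)]; this uses [a + b < 0]. *)
Lemma ratio_bound (k : nat) : (0 < N)%N -> a + b < 0 -> (1 < k)%N ->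
  1 - b = k%:R * (a - b) ->
  (k.*2.-1 ^ 2 * N <= k.*2.-1 ^ 2 * n.+1 + n.+1 * N.-1)%N.
Proof.
move=> N0 ab0 k1 bk; have ba0 : 0 < a - b by rewrite subr_gt0.
pose mu : R := 2 * k%:R - 1.
have k1R : 1 < k%:R :> R by rewrite ltr1n.
have mu0 : 0 < mu by rewrite /mu; lra.
(* Chosen so that [x a + y = 1 / mu], [x b + y = - 1 / mu] and [x + y = 1]. *)
pose x := 2 / ((a - b) * mu); pose y := - (a + b) / ((a - b) * mu).
have x0 : 0 <= x by rewrite divr_ge0 // mulr_ge0 ?ltW.
have y0 : 0 <= y by rewrite divr_ge0 ?mulr_ge0 ?ltW // oppr_gt0.
pose Y i := row_mx (Num.sqrt x *: X i) (const_mx (Num.sqrt y) : 'rV[R]_1).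
have YE i j : dot (Y i) (Y j) = x * dot (X i) (X j) + y.
  rewrite /dot big_split_ord big_ord1 /= !row_mxEr !mxE -!expr2 sqr_sqrtr //.
  congr (_ + _); rewrite mulr_sumr; apply: eq_bigr => l _.
  by rewrite !row_mxEl !mxE mulrACA -expr2 sqr_sqrtr.
have nz : (mu != 0) && (a - b != 0) by rewrite !gt_eqF.
have Y1 i : dot (Y i) (Y i) = 1.
  rewrite YE X1 /x /y; apply: (@mulfI _ ((a - b) * mu)); first by rewrite mulf_neq0 ?gt_eqF.
  have -> : (a - b) * mu * (2 / ((a - b) * mu) * 1 + - (a + b) / ((a - b) * mu)) = 2 - (a + b).
    by field.
  by rewrite /mu; lra.
have Yab i j : i != j -> dot (Y i) (Y j) = mu^-1 \/ dot (Y i) (Y j) = - mu^-1.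
  by move=> /Xab[] h; [left | right]; rewrite YE h /x /y; field.
have [p [q [pq sumY]]] := pair_counts Y1 Yab.
(* The degree 2 inequality in dimension [n + 1] sees only squares, so the pair counts enter through
   [p + q = N (N - 1)] alone. *)
have := zonal_sum_ge0 Y1 2 (ltn_addl n (ltn0Sn 0)).
rewrite (sumY (zonal (n + 1) 2)) /= sqrrN -addrA -mulrDl -natrD pq natrM.
rewrite expr1n mulr1 -mulrA -mulrDr pmulr_rge0 ?ltr0n // natrD addrK => ineq.
have muE : (k.*2.-1)%:R = mu.
  by rewrite -subn1 natrB ?double_gt0 ?(ltnW k1) // -muln2 natrM mulrC.
rewrite -(ler_nat R) (natrD _ (_ ^ 2 * _)) (natrM _ (_ ^ 2) N).
rewrite (natrM _ (_ ^ 2) n.+1) (natrM _ n.+1) natrX muE -[in leLHS](prednK N0).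
have mu2 : mu ^+ 2 * mu^-1 ^+ 2 = 1 by rewrite -exprMn mulfV ?expr1n ?gt_eqF.
rewrite -subr_ge0 (_ : _ - _ =
  mu ^+ 2 * (n%:R + N.-1%:R * ((n%:R + 1) * mu^-1 ^+ 2 - 1))).
  by rewrite mulr_ge0 ?sqr_ge0.
rewrite (_ : mu ^+ 2 * (_ + _) = mu ^+ 2 * n%:R +
  N.-1%:R * ((n%:R + 1) * (mu ^+ 2 * mu^-1 ^+ 2) - mu ^+ 2)); last by ring.
by rewrite mu2 -!natr1; ring.
Qed.
End LarmanRogersSeidel.

(** * The linear programming bound *)

Local Delimit Scope Z_scope with Z.
Local Arguments Z.add : simpl never.
Local Arguments Z.mul : simpl never.

(** * Integer polynomials and their lower bounds on an interval *)

Section IntegerPolynomials.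

(** Polynomials are coefficient lists, constant term first, over binary integers, so that
    [vm_compute] can evaluate the certificates. *)
Fixpoint padd (p q : seq Z) : seq Z :=
  match p, q with
  | c :: p', d :: q' => (c + d)%Z :: padd p' q'
  | [::], _ => q
  | _, [::] => p
  end.

Definition pscale (c : Z) (p : seq Z) : seq Z := [seq (c * d)%Z | d <- p].

Definition psub (p q : seq Z) : seq Z := padd p (pscale (-1)%Z q).

Fixpoint pmul (p q : seq Z) : seq Z :=
  if p is c :: p' then padd (pscale c q) (0%Z :: pmul p' q) else [::].

(* A lower bound on [0, w]: Horner's scheme in interval arithmetic. *)
Definition lower_bound (w : Z) (p : seq Z) : Z :=
  foldr (fun c m => c + Z.min 0 (w * m))%Z 0%Z p.

Variable R : realType.

Definition ZR (z : Z) : R := (int_of_Z z)%:~R.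

Definition peval (p : seq Z) (t : R) : R :=
  foldr (fun c r => ZR c + t * r) 0 p.

Lemma ZRD x y : ZR (x + y)%Z = ZR x + ZR y.
Proof. by rewrite /ZR -rmorphD; congr (_%:~R); lia. Qed.

Lemma ZRM x y : ZR (x * y)%Z = ZR x * ZR y.
Proof. by rewrite /ZR -rmorphM; congr (_%:~R); lia. Qed.

Lemma ZRN x : ZR (- x)%Z = - ZR x.
Proof. by rewrite /ZR -rmorphN; congr (_%:~R); lia. Qed.

Lemma ZR_nat n : ZR (Z.of_nat n) = n%:R.
Proof. by rewrite /ZR (_ : int_of_Z _ = n) //; lia. Qed.

Lemma ZR_le x y : (x <= y)%Z -> ZR x <= ZR y.
Proof. by move=> xy; rewrite ler_int; lia. Qed.

Lemma ZR_lt x y : (x < y)%Z -> ZR x < ZR y.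
Proof. by move=> xy; rewrite ltr_int; lia. Qed.

Lemma peval_add p q t : peval (padd p q) t = peval p t + peval q t.
Proof.
elim: p q => [|c p IHp] [|d q] /=; rewrite ?add0r ?addr0 //.
by rewrite IHp ZRD; ring.
Qed.

Lemma peval_scale c p t : peval (pscale c p) t = ZR c * peval p t.
Proof. by elim: p => [|d p IHp] /=; rewrite ?mulr0 // IHp ZRM; ring. Qed.

Lemma peval_sub p q t : peval (psub p q) t = peval p t - peval q t.
Proof. by rewrite peval_add peval_scale (ZRN 1) mulN1r. Qed.

Lemma peval_mul p q t : peval (pmul p q) t = peval p t * peval q t.
Proof.
elim: p => [|c p IHp] /=; first by rewrite mul0r.
by rewrite peval_add peval_scale /= IHp add0r; ring.
Qed.

Lemma lower_boundP w p t : 0 <= t <= ZR w -> ZR (lower_bound w p) <= peval p t.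
Proof.
case/andP => t0 tw; elim: p => [|c p IHp] //=.
rewrite ZRD lerD2l; set m := lower_bound w p in IHp *.
have [m0|m0] := Z.le_ge_cases 0 m.
  apply: le_trans (_ : 0 <= _); first by apply: (@ZR_le _ 0%Z); lia.
  by rewrite mulr_ge0 // (le_trans _ IHp) //; apply: (@ZR_le 0%Z).
apply: le_trans (_ : ZR (w * m) <= _); first by apply: ZR_le; lia.
rewrite ZRM; apply: le_trans (ler_wpM2l t0 IHp).
by rewrite ler_wnM2r //; apply: (@ZR_le _ 0%Z).
Qed.

End IntegerPolynomials.

(* Everything is homogenized to clear denominators: a polynomial [p] stands for
   the inner product [p / M]. *)
Section DelsarteCertificate.
Variables n N M : Z.

Definition zonal_poly (d : nat) (p : seq Z) : seq Z :=
  let p2 := pmul p p in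
  match d with
  | 1 => p
  | 2 => psub (pscale n p2) [:: M * M]%Z
  | 3 => psub (pscale (n + 2)%Z (pmul p p2)) (pscale (3 * (M * M))%Z p)
  | 4 => padd (psub (pscale ((n + 2) * (n + 4))%Z (pmul p2 p2))
                 (pscale (6 * (n + 2) * (M * M))%Z p2))
           [:: 3 * (M * M) * (M * M)]%Z
  | _ => [:: 1%Z]
  end.

Definition zonal_one (d : nat) : Z :=
  match d with
  | 1 => M
  | 2 => ((n - 1) * (M * M))%Z
  | 3 => ((n - 1) * (M * M * M))%Z
  | 4 => ((n * n - 1) * (M * M) * (M * M))%Z
  | _ => 1%Z
  end.

(* The multipliers are chosen so that, for [d != e], the two coefficients
   [m1 * A1 + m2 * A2] and [m1 * B1 + m2 * B2] coincide. *)
Definition certified (A B : seq Z) (w : Z) (de : nat * nat) : bool :=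
  let: (d, e) := de in
  let A1 := zonal_poly d A in let A2 := zonal_poly e A in
  let B1 := zonal_poly d B in let B2 := zonal_poly e B in
  let m1 := if d == e then [:: 1%Z] else psub A2 B2 in
  let m2 := if d == e then [::] else psub B1 A1 in
  let total := padd (pscale (zonal_one d) m1) (pscale (zonal_one e) m2) in
  let neg C1 C2 := Z.ltb 0 (lower_bound w (psub [::]
    (padd total (pscale (N - 1)%Z (padd (pmul m1 C1) (pmul m2 C2)))))) in
  [&& Z.leb 0 (lower_bound w m1), Z.leb 0 (lower_bound w m2),
      neg A1 A2 & neg B1 B2].

(** The parameter is shifted by [l] so that the interval starts at 0. Swapping the degrees of a pair
    changes the sign of both multipliers, so the order matters. *)
Definition certified_by_some (A1 B0 B1 l w : Z) : bool :=
  has (certified [:: A1 * l; A1]%Z [:: B0 + B1 * l; B1]%Z w)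
    [:: (2, 3); (3, 3); (4, 4); (1, 1); (3, 1); (2, 1); (3, 4); (4, 3)].

(* [if] rather than [||], so that [vm_compute], which is strict, does not
   evaluate the bisection to full depth. *)
Fixpoint covered (A1 B0 B1 : Z) (fuel : nat) (l w : Z) : bool :=
  if certified_by_some A1 B0 B1 l w then true else
  if fuel is fuel'.+1 then
    let h := Z.div w 2 in
    if covered A1 B0 B1 fuel' l h
    then covered A1 B0 B1 fuel' (l + h)%Z (w - h)%Z else false
  else false.

End DelsarteCertificate.

Local Arguments certified_by_some : simpl never.

(* [a = t / M] and [b = (k a - 1) / (k - 1)], for [t / M] ranging over
   [[(2 - k) / k, 1 / (2 k - 1)]]. *)
Definition ratio_covered (n N k : nat) : bool :=
  let n := Z.of_nat n in let N := Z.of_nat N in let k := Z.of_nat k in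
  (* The factor [k (2 k - 1)] makes both endpoints integers, and [16384 = 2 ^ 14] makes the 14
     levels of halving exact. The common denominator of [a] and [b] is [(k - 1) M]. *)
  let M := (k * (2 * k - 1) * 16384)%Z in
  covered n N ((k - 1) * M) (k - 1) (- M) k 14
    ((2 - k) * (2 * k - 1) * 16384)
    ((k + (k - 2) * (2 * k - 1)) * 16384).

(** The exception at 23 is one more than [23 * 24 / 2 = 276], which leaves two possible values
    there. *)
Definition size_bound n := if n == 23 then 277 else (n * n.+1 %/ 2)%N.

(** The lists are 7 to 21 and 23 to 39. One point above the bound is enough, since a larger set
    contains such a family. *)
Lemma ratio2_covered :
  all (fun n => ratio_covered n (size_bound n).+1 2) (iota 7 15 ++ iota 23 17).
Proof. by vm_compute. Qed.

Lemma ratio3_covered :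
  all (fun n => ratio_covered n (size_bound n).+1 3) (iota 23 17).
Proof. by vm_compute. Qed.

(** * Soundness of the certificates *)

Section CertificateSoundness.
Variables (R : realType) (n N : nat) (M : Z) (a b p q : R).
Hypotheses (M_gt0 : (0 < M)%Z) (N_gt1 : (1 < N)%N).
Hypotheses (p_ge0 : 0 <= p) (q_ge0 : 0 <= q) (pqE : p + q = N%:R * (N%:R - 1)).
Hypothesis zonal_ge0 : forall d,
  0 <= N%:R * zonal n d 1 + p * zonal n d a + q * zonal n d b.

Let scale (d : nat) : R := ZR R M ^+ (if (d <= 4)%N then d else 0%N).

Lemma ZR_M_gt0 : 0 < ZR R M. Proof. exact: (@ZR_lt R 0%Z). Qed.

Lemma scale_gt0 d : 0 < scale d. Proof. exact/exprn_gt0/ZR_M_gt0. Qed.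

Lemma zonal_polyP d A t x : peval A t = ZR R M * x ->
  peval (zonal_poly (Z.of_nat n) M d A) t = scale d * zonal n d x.
Proof.
have Z1 : ZR R 1 = 1 by []. have Z2 : ZR R 2 = 2 by [].
have Z3 : ZR R 3 = 3 by [].
have Z4 : ZR R 4 = 4 by []. have Z6 : ZR R 6 = 6 by [].
move=> At; rewrite /scale; case: d => [|[|[|[|[|d]]]]] /=;
  rewrite ?(peval_add, peval_sub, peval_scale, peval_mul) /= ?At
    ?(ZRD, ZRM) ?ZR_nat ?Z1 ?Z2 ?Z3 ?Z4 ?Z6; ring.
Qed.

Lemma zonal_oneP d : ZR R (zonal_one (Z.of_nat n) M d) = scale d * zonal n d 1.
Proof.
have Z1 : ZR R 1 = 1 by [].
rewrite /scale; case: d => [|[|[|[|[|d]]]]] /=;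
  rewrite ?(ZRD, ZRM, ZRN) ?ZR_nat ?Z1; ring.
Qed.

(** Multiply the combined inequality by [N - 1] and spread its constant term over
    [p + q = N (N - 1)]: this gives [p U + q V >= 0], whereas the certificate makes [U] and [V]
    negative. *)
Lemma certified_infeasible A B w de t :
  0 <= t <= ZR R w -> peval A t = ZR R M * a -> peval B t = ZR R M * b ->
  ~~ certified (Z.of_nat n) (Z.of_nat N) M A B w de.
Proof.
case: de => d e tw At Bt; apply/negP.
rewrite /certified; set m1 := if _ then _ else _; set m2 := if _ then _ else _.
case/and4P => /Z.leb_le m1_ge0 /Z.leb_le m2_ge0 /Z.ltb_lt negA /Z.ltb_lt negB.
have nonneg m : (0 <= lower_bound w m)%Z -> 0 <= peval m t.
  by move=> h; apply: le_trans (lower_boundP m tw); exact: (@ZR_le R 0%Z).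
have pos m : (0 < lower_bound w m)%Z -> 0 < peval m t.
  by move=> h; apply: lt_le_trans (lower_boundP m tw); exact: (@ZR_lt R 0%Z).
have {}negA := pos _ negA; have {}negB := pos _ negB.
have x0 := nonneg _ m1_ge0; have y0 := nonneg _ m2_ge0.
move: negA negB; rewrite !(peval_sub, peval_add, peval_scale, peval_mul).
rewrite !zonal_oneP !(zonal_polyP _ At, zonal_polyP _ Bt) /=.
move: (peval m1 t) (peval m2 t) x0 y0 => x y x0 y0.
rewrite (ZRD R (Z.of_nat N) (-1)) ZR_nat (_ : ZR R (-1) = -1) //.
have Sd := mulr_ge0 x0 (mulr_ge0 (ltW (scale_gt0 d)) (zonal_ge0 d)).
have Se := mulr_ge0 y0 (mulr_ge0 (ltW (scale_gt0 e)) (zonal_ge0 e)).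
move: Sd Se; move: (scale d) (scale e) => sd se Sd Se.
set U := _ + _ * (_ * (sd * zonal n d a) + _).
set V := _ + _ * (_ * (sd * zonal n d b) + _) => UA VB.
have N1 : 0 < N%:R - 1 :> R by rewrite subr_gt0 ltr1n.
have : 0 <= p * U + q * V.
  rewrite (_ : _ + _ = (N%:R - 1) *
   (x * (sd * (N%:R * zonal n d 1 + p * zonal n d a + q * zonal n d b)) +
    y * (se * (N%:R * zonal n e 1 + p * zonal n e a + q * zonal n e b)))).
    by apply: mulr_ge0; [exact: ltW | exact: addr_ge0].
  have -> : q = N%:R * (N%:R - 1) - p by rewrite -pqE; ring.
  by rewrite /U /V; ring.
have U0 : U < 0 by rewrite sub0r oppr_gt0 in UA.
have V0 : V < 0 by rewrite sub0r oppr_gt0 in VB.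
have pq0 : 0 < p + q by rewrite pqE mulr_gt0 // ltr0n ltnW.
have [p_gt0|] := ltrP 0 p.
  rewrite leNgt => /negP; apply; rewrite -(addr0 0) ltr_leD //.
    by rewrite pmulr_rlt0.
  by rewrite mulr_ge0_le0 // ltW.
move=> p_le0; have p0 : p = 0 by apply/eqP; rewrite eq_le p_le0.
by move: pq0; rewrite p0 add0r mul0r add0r => q0; rewrite pmulr_rge0 // leNgt V0.
Qed.

Lemma certified_by_some_infeasible A1 B0 B1 l w t :
  ZR R l <= t <= ZR R (l + w) ->
  ZR R A1 * t = ZR R M * a -> ZR R B0 + ZR R B1 * t = ZR R M * b ->
  certified_by_some (Z.of_nat n) (Z.of_nat N) M A1 B0 B1 l w = false.
Proof.
move=> tlw At Bt; apply/hasPn => de _.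
apply: (@certified_infeasible _ _ _ _ (t - ZR R l)); rewrite /= ?ZRD ?ZRM.
- by rewrite subr_ge0 lerBlDl -ZRD.
- by rewrite -At; ring.
- by rewrite -Bt; ring.
Qed.

Lemma covered_infeasible A1 B0 B1 fuel l w t :
  ZR R l <= t <= ZR R (l + w) ->
  ZR R A1 * t = ZR R M * a -> ZR R B0 + ZR R B1 * t = ZR R M * b ->
  ~~ covered (Z.of_nat n) (Z.of_nat N) M A1 B0 B1 fuel l w.
Proof.
move=> tlw At Bt; elim: fuel l w tlw => [|fuel IH] l w tlw /=;
  rewrite (certified_by_some_infeasible tlw At Bt) //.
have [th|th] := lerP t (ZR R (l + w / 2)).
  rewrite (negPf (IH l (w / 2)%Z _)) //.
  by rewrite th andbT; case/andP: tlw.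
case: ifP => // _; apply: IH.
by rewrite (ltW th) /=; case/andP: tlw => _; congr (_ <= ZR R _); lia.
Qed.

End CertificateSoundness.

(** With [b = (k a - 1) / (k - 1)], the condition [-1 <= b] gives the left end of the interval for
    [a], and [a + b <= 0] the right end. *)
Lemma ratio_infeasible (R : realType) (n N k : nat) (a b p q : R) :
  (1 < k)%N -> (1 < N)%N -> 1 - b = k%:R * (a - b) -> -1 <= b -> a + b <= 0 ->
  0 <= p -> 0 <= q -> p + q = N%:R * (N%:R - 1) ->
  (forall d, 0 <= N%:R * zonal n d 1 + p * zonal n d a + q * zonal n d b) ->
  ~~ ratio_covered n N k.
Proof.
move=> k1 N1 bk b1 ab p0 q0 pqE zonal0; rewrite /ratio_covered.
have : (0 < 16384)%Z by []; move: 16384%Z => S S_gt0.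
set K := Z.of_nat k; set M := (K * (2 * K - 1) * S)%Z.
have kR : 1 < k%:R :> R by rewrite ltr1n.
have Z1 : ZR R 1 = 1 by []. have Z2 : ZR R 2 = 2 by [].
have KR : ZR R K = k%:R by rewrite ZR_nat.
have s0 : 0 < ZR R S by apply: (@ZR_lt R 0%Z).
have ME : ZR R M = k%:R * (2 * k%:R - 1) * ZR R S.
  by rewrite !ZRM ZRD ZRM KR Z2.
have KE : ZR R (K - 1) = k%:R - 1 by rewrite ZRD KR.
apply: (@covered_infeasible R n N ((K - 1) * M)%Z a b p q _ N1 p0 q0 pqE zonal0
  _ _ _ _ _ _ (a * ZR R M)).
- by apply: Z.mul_pos_pos; [|apply: Z.mul_pos_pos; first apply: Z.mul_pos_pos]; rewrite /K; lia.
- have bE : (k%:R - 1) * b = k%:R * a - 1 by lra.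
  have low : 2 - k%:R <= k%:R * a.
    have : 0 <= (k%:R - 1) * (b + 1) by rewrite mulr_ge0 ?subr_ge0 ?(ltW kR) //; lra.
    by lra.
  have high : (2 * k%:R - 1) * a <= 1.
    have : (k%:R - 1) * (a + b) <= 0.
      by rewrite mulr_ge0_le0 ?subr_ge0 ?(ltW kR).
    by lra.
  rewrite (_ : (2 - K) * _ * _ + _ = K * S)%Z; last by ring.
  rewrite ME !ZRM ZRD ZRN ZRD ZRN ZRM KR Z1 Z2; apply/andP; split.
    rewrite mulrA; apply: ler_wpM2r; first exact: ltW.
    rewrite [leRHS](_ : _ = k%:R * a * (2 * k%:R - 1)); last by ring.
    by apply: ler_wpM2r => //; lra.
  rewrite mulrA; apply: ler_wpM2r; first exact: ltW.
  rewrite [leLHS](_ : _ = k%:R * ((2 * k%:R - 1) * a)); last by ring.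
  by rewrite ger_pMr // (lt_trans _ kR).
- by rewrite KE ZRM KE; ring.
- rewrite ZRM ZRN KE KR (_ : (k%:R - 1) * _ * b = ZR R M * ((k%:R - 1) * b)).
    have -> : (k%:R - 1) * b = k%:R * a - 1 by lra.
    by ring.
  by ring.
Qed.

(** * Two-distance sets and families *)

Lemma card_gt_family T (S : set T) m : ~ (S #<= `I_m)%card ->
  exists2 X : 'I_m.+1 -> T, injective X & forall i, S (X i).
Proof.
move=> Sm; have : ([set: 'I_m.+1]%classic #<= S)%card.
  rewrite -(card_le_eql (@card_II m.+1)).
  have [/finite_setP[k Sk]|/infiniteP inf] := pselect (finite_set S).
    by rewrite (card_le_eqr Sk) card_le_II ltnNge -card_le_II -(card_le_eql Sk); apply/negP.
  exact: card_le_trans (card_leT _) inf.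
case/card_leP => f; exists (fun i => set_val (f (to_setT i))) => [i j|i].
  by move=> /val_inj /(inj (mem_set I) (mem_set I)) /(congr1 set_val).
exact: set_valP.
Qed.

Lemma card_range_ord T m (X : 'I_m -> T) :
  injective X -> (range X #= `I_m)%card.
Proof.
move=> Xinj; apply: card_eq_trans (card_esym card_II).
by apply: inj_card_eq => i j _ _; exact: Xinj.
Qed.

Section TwoDistanceFamilies.
Variables (R : realType) (n : nat).

Definition two_distance_family N (X : 'I_N -> 'rV[R]_n) (a b : R) :=
  [/\ forall i, dot (X i) (X i) = 1, -1 <= a < 1, -1 <= b < 1 &
      forall i j, i != j -> dot (X i) (X j) = a \/ dot (X i) (X j) = b].

Lemma enorm_eq1 (u : 'rV[R]_n) : enorm u = 1 <-> dot u u = 1.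
Proof.
have d0 : 0 <= dot u u by apply: sumr_ge0 => i _; rewrite -expr2 sqr_ge0.
rewrite /enorm; split => [u1|->]; last by rewrite sqrtr1.
by rewrite -(sqr_sqrtr d0) u1 expr1n.
Qed.

Lemma two_distance_family_set N (X : 'I_N -> 'rV[R]_n) a b :
  two_distance_family X a b ->
  exists2 S : set 'rV[R]_n, spherical_two_distance S & (S #= `I_N)%card.
Proof.
case=> X1 a1 b1 Xab; exists (range X).
  split; first by move=> _ [i _ <-]; exact/enorm_eq1.
  exists a, b; split=> // _ _ [i _ <-] [j _ <-] Xij; apply: Xab.
  by apply: contra_notN Xij => /eqP ->.
(* Equal vectors would have inner product 1, but [a] and [b] are less than 1. *)
apply: card_range_ord => i j Xij; apply/eqP/negPn/negP => /Xab.
case/andP: a1 => _ /lt_eqF a1; case/andP: b1 => _ /lt_eqF b1.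
by rewrite -Xij X1 => -[] /esym/eqP; rewrite ?a1 ?b1.
Qed.

Lemma two_distance_set_family N (S : set 'rV[R]_n) :
  spherical_two_distance S -> ~ (S #<= `I_N)%card ->
  exists X : 'I_N.+1 -> 'rV[R]_n, exists a b, two_distance_family X a b.
Proof.
case=> S1 [a [b [a1 b1 Sab]]] /card_gt_family[X Xinj SX]; exists X, a, b.
split=> // [i|i j ij]; first exact/enorm_eq1/S1.
by apply: Sab => // /Xinj/eqP; rewrite (negPf ij).
Qed.

End TwoDistanceFamilies.

(** * The upper bound *)

Lemma size_bound_ge n : (n * n.+1 %/ 2 <= size_bound n)%N.
Proof. by rewrite /size_bound; case: eqP => [->|]. Qed.

Lemma ratio_small (n k : nat) : (6 < n < 22)%N \/ (22 < n < 40)%N -> (1 < k)%N ->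
  (k.*2.-1 ^ 2 * (size_bound n).+1 <=
   k.*2.-1 ^ 2 * n.+1 + n.+1 * size_bound n)%N ->
  (k == 2) || (k == 3) && (22 < n)%N.
Proof.
move=> n_range k1; set e := (_ ^ 2)%N; set B := size_bound n => bound.
(* [excludes c m] is the failure of the bound with [c] for [(2 k - 1)^2]. It persists for larger
   [c]; the values 49 and 25 used below belong to [k = 4] and [k = 3]. *)
pose excludes c m := (c * m.+1 + m.+1 * size_bound m < c * (size_bound m).+1)%N.
have lt_bound c : excludes c n -> (e < c)%N.
  rewrite /excludes -/B => h; have nB : (n < B)%N by nia.
  by nia.
have e49 : (e < 49)%N.
  apply: lt_bound; suff /allP : all (excludes 49) (iota 7 15 ++ iota 23 17).
    by apply; rewrite mem_cat !mem_iota; lia.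
  by vm_compute.
have k3 : (k <= 3)%N by rewrite leqNgt; apply/negP => k4; rewrite /e in e49; nia.
have [n22|n22] := ltnP 22 n; first by lia.
have e25 : (e < 25)%N.
  apply: lt_bound; suff /allP : all (excludes 25) (iota 7 15).
    by apply; rewrite mem_iota; lia.
  by vm_compute.
suff : (k < 3)%N by lia.
by rewrite ltnNge; apply/negP => k4; rewrite /e in e25; nia.
Qed.

Lemma no_larger_family (R : realType) (n : nat) (X : 'I_(size_bound n).+1 -> 'rV[R]_n) a b :
  (6 < n < 22)%N \/ (22 < n < 40)%N -> ~ two_distance_family X a b.
Proof.
move=> n_range; wlog ba : a b / b <= a => [th [X1 a1 b1 Xab]|].
  have [ba|/ltW ab] := leP b a; first exact: th ba _.
  by apply: th ab _; split=> // i j /Xab[]; [right | left].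
set N := (size_bound n).+1 in X *.
case=> X1 /andP[a_ge a_lt] /andP[b_ge b_lt] Xab.
have n0 : (0 < n)%N by lia.
have N_large : (n * n.+1 < 2 * N)%N.
  by have := size_bound_ge n; rewrite /N; lia.
have nonneg c d : (forall i j, i != j -> dot (X i) (X j) = c \/ dot (X i) (X j) = d) ->
    c < 1 -> d < 1 -> c + d < 0.
  move=> Xcd c1 d1; rewrite ltNge; apply/negP => cd0.
  have := bound_of_nonneg_sum X1 Xcd c1 d1 cd0.
  by have := size_bound_ge n; rewrite /N; lia.
have ab0 := nonneg _ _ Xab a_lt b_lt.
have [p [q [pq sumX]]] := pair_counts X1 Xab.
have N1 : (1 < N)%N by nia.
have NR : 1 < N%:R :> R by rewrite ltr1n.
have pqE : p%:R + q%:R = N%:R * (N%:R - 1) :> R.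
  by rewrite -natrD pq natrM -subn1 natrB // ltnW.
have zonal0 d : 0 <= N%:R * zonal n d 1 + p%:R * zonal n d a + q%:R * zonal n d b :> R.
  by rewrite -sumX; exact: zonal_sum_ge0.
have [ab|b_ne_a] := eqVneq b a; last first.
  have {}ba : b < a by rewrite lt_neqAle b_ne_a.
  have [|k k1 bk] := ratio_int X1 Xab ba a_lt; first by nia.
  have bound := ratio_bound X1 Xab ba (ltnW N1) ab0 k1 bk.
  have notcov := ratio_infeasible k1 N1 bk b_ge (ltW ab0) (ler0n _ p) (ler0n _ q) pqE zonal0.
  case/orP: (ratio_small n_range k1 bound) notcov => [/eqP ->|/andP[/eqP -> n22]].
    rewrite (allP ratio2_covered) // mem_cat !mem_iota; lia.
  by rewrite (allP ratio3_covered) // mem_iota; lia.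
rewrite {}ab in b_ge b_lt Xab ab0 zonal0 *.
(* Here all inner products equal [a], and the degree 1 inequality reads [1 + (N - 1) a >= 0]. *)
have a_gt : -1 < a.
  have := zonal0 1; rewrite /= mulr1 -addrA -mulrDl pqE -mulrA -{1}[N%:R]mulr1.
  rewrite -mulrDr pmulr_rge0 ?(lt_trans ltr01) // => h.
  have N2 : 2 < N%:R :> R by rewrite ltr_nat; nia.
  rewrite ltNge; apply/negP => a_le.
  have : (N%:R - 1) * (a + 1) <= 0 by rewrite mulr_ge0_le0 //; lra.
  by lra.
(* The second value is free, so it may be taken to be [- a]; the sum 0 then contradicts [nonneg]. *)
suff : a - a < 0 by rewrite subrr ltxx.
apply: nonneg => [i j ij||] //; last by lra.
by left; case: (Xab i j ij).
Qed.

(** * The lower bound: edge midpoints of a regular simplex *)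

Section SimplexMidpoints.
Variables (R : realType) (n : nat).
Hypothesis n_gt0 : (0 < n)%N.

Let r : R := (Num.sqrt n.+1%:R)^-1.

(** A regular simplex centred at 0: basis vectors shifted along the all-ones vector, and a multiple
    of that vector. Its Gram matrix is that of the standard basis of [R^(n+1)] projected to the
    hyperplane of coordinate sum 0. *)
Definition vertex (i : 'I_n.+1) : 'rV[R]_n :=
  \row_j (if unlift ord_max i is Some i' then (i' == j)%:R - (1 - r) / n%:R
          else - r).

Lemma simplex_scale_sqr : r ^+ 2 = n.+1%:R^-1.
Proof. by rewrite exprVn sqr_sqrtr ?ler0n. Qed.

Lemma dot_vertex i j : dot (vertex i) (vertex j) = (i == j)%:R - n.+1%:R^-1.
Proof.
have n0 : n%:R != 0 :> R by rewrite pnatr_eq0 -lt0n.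
have n1 : n%:R + 1 != 0 :> R by rewrite natr1 pnatr_eq0.
have rE : n%:R * r ^+ 2 = 1 - r ^+ 2 by rewrite simplex_scale_sqr -natr1; field.
have one l : \sum_(k < n) (l == k)%:R = 1 :> R.
  by rewrite (bigD1 l) //= eqxx big1 ?addr0 // => k; rewrite eq_sym => /negPf ->.
have cross l : \sum_(k < n) ((l == k)%:R - (1 - r) / n%:R) * r = r ^+ 2.
  rewrite -mulr_suml sumrB one sumr_const card_ord -[_ *+ n]mulr_natl.
  by rewrite mulrCA divff // mulr1; ring.
rewrite -simplex_scale_sqr /dot; under eq_bigr => k _ do rewrite !mxE.
case: (unliftP ord_max i) => [i' ->|->]; case: (unliftP ord_max j) => [j' ->|->].
- rewrite (inj_eq lift_inj).
  rewrite (eq_bigr (fun k => (k == i')%:R * (j' == k)%:R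
    - (1 - r) / n%:R * (i' == k)%:R - (1 - r) / n%:R * (j' == k)%:R
    + ((1 - r) / n%:R) ^+ 2)) => [|k _]; last by rewrite [k == _]eq_sym; ring.
  rewrite big_split !sumrB /= sumr_const card_ord sum_delta -!mulr_sumr !one.
  rewrite -[_ *+ n]mulr_natl [j' == _]eq_sym.
  suff : n%:R * ((1 - r) / n%:R) ^+ 2 - 2 * ((1 - r) / n%:R) = - r ^+ 2 by lra.
  apply: (mulfI n0); transitivity ((1 - r) ^+ 2 - 2 * (1 - r)); first by field.
  by rewrite mulrN rE; ring.
- rewrite lift_eqF sub0r -(cross i') -sumrN.
  by apply: eq_bigr => k _; rewrite mulrN.
- rewrite eq_liftF sub0r -(cross j') -sumrN.
  by apply: eq_bigr => k _; rewrite mulNr mulrC.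
- by rewrite eqxx sumr_const card_ord mulrNN -expr2 -[_ *+ n]mulr_natl rE.
Qed.

(** For a pair [A] this is twice the midpoint; the scale disappears on normalization. *)
Definition midpoint (A : {set 'I_n.+1}) : 'rV[R]_n := \sum_(i in A) vertex i.

Lemma dot_midpoint (A B : {set 'I_n.+1}) : #|A| = 2 -> #|B| = 2 ->
  dot (midpoint A) (midpoint B) = #|A :&: B|%:R - 4 / n.+1%:R.
Proof.
move=> A2 B2; transitivity (\sum_(i in A) \sum_(j in B) dot (vertex i) (vertex j)).
  rewrite /dot; under [RHS]eq_bigr => i _ do rewrite exchange_big /=.
  rewrite exchange_big /=; apply: eq_bigr => k _.
  rewrite /midpoint !summxE mulr_suml; apply: eq_bigr => i _.
  by rewrite mulr_sumr.
under eq_bigr => i _ do under eq_bigr => j _ do rewrite dot_vertex.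
under eq_bigr => i _ do rewrite sumrB sumr_const B2.
rewrite sumrB sumr_const A2 -!mulrnA -[_ *+ (2 * 2)]mulr_natl; congr (_ - _).
rewrite (eq_bigr (fun i => (i \in B)%:R)) => [|i _].
  rewrite -natr_sum -big_mkcondr sum1_card; congr (_%:R).
  by apply: eq_card => i; rewrite !inE.
have [iB|iB] := boolP (i \in B).
  rewrite (bigD1 i) //= eqxx big1 ?addr0 // => j /andP[_ /negPf].
  by rewrite eq_sym => ->.
rewrite big1 // => j jB; case: eqP => // ij.
by rewrite ij jB in iB.
Qed.

End SimplexMidpoints.

Lemma midpoint_family (R : realType) (n : nat) : (6 < n)%N ->
  exists X : 'I_('C(n.+1, 2)) -> 'rV[R]_n, exists a b, two_distance_family X a b.
Proof.
move=> n6; have n0 : (0 < n)%N by lia.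
pose D := [set A : {set 'I_n.+1} | #|A| == 2].
have cardD : #|D| = 'C(n.+1, 2) by rewrite card_draws card_ord.
have n7 : 7 <= n%:R :> R by rewrite ler_nat.
have n1 : 0 < n.+1%:R :> R by rewrite ltr0n.
have [s sE [s_gt0 s_le]] : exists2 s, s = 4 / n.+1%:R & 0 < s /\ s <= 1 / 2 :> R.
  exists (4 / n.+1%:R) => //; split; first by rewrite divr_gt0.
  by rewrite ler_pdivrMr // -natr1; lra.
(* The squared length of the sum of two vertices. *)
pose c : R := 2 - s.
have c_gt0 : 0 < c by rewrite /c; lra.
pose Y i : 'rV[R]_n := (Num.sqrt c)^-1 *: midpoint R (@enum_val _ [in D] i).
have YE i j : dot (Y i) (Y j) =
    (#|enum_val i :&: enum_val j|%:R - s) / c.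
  have two k : #|@enum_val _ [in D] k| = 2.
    by have := enum_valP k; rewrite inE => /eqP.
  rewrite sE -(dot_midpoint R n0 (two i) (two j)) /dot mulr_suml.
  apply: eq_bigr => k _; rewrite !mxE mulrACA -expr2 exprVn sqr_sqrtr ?ltW //.
  by rewrite mulrC.
suff : two_distance_family Y ((1 - s) / c) ((0 - s) / c).
  rewrite /Y; move: (@enum_val _ [in D]); rewrite cardD => e H.
  by exists (fun i => (Num.sqrt c)^-1 *: midpoint R (e i)); do 2!eexists; exact: H.
split.
- move=> i; rewrite YE setIid; have := enum_valP i; rewrite inE => /eqP ->.
  by rewrite divff // gt_eqF.
- by rewrite ler_pdivlMr // ltr_pdivrMr //; apply/andP; split; rewrite /c; lra.
- by rewrite ler_pdivlMr // ltr_pdivrMr //; apply/andP; split; rewrite /c; lra.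
move=> i j ij; rewrite YE.
(* Distinct edges share one vertex or none, which yields the two inner products. *)
have : (#|enum_val i :&: enum_val j| < 2)%N.
  have := enum_valP i; have := enum_valP j; rewrite !inE => /eqP j2 /eqP i2.
  rewrite ltnNge -[X in (X <= _)%N]i2; apply/negP => le_ij.
  have ii : enum_val i :&: enum_val j == enum_val i by rewrite eqEcard subsetIl.
  have jj : enum_val i :&: enum_val j == enum_val j.
    by rewrite eqEcard subsetIr j2 -i2.
  by case/eqP: ij; apply: enum_val_inj; rewrite -(eqP ii) {1}(eqP jj).
by case: #|_| => [|[|//]] _; [right | left].
Qed.

Theorem theorem7 (R : realType) :
  (forall n : nat, (6 < n < 22)%N \/ (23 < n < 40)%N ->
     g_eq R n ((n * (n + 1)) %/ 2)%N) /\
  (g_eq R 23 276 \/ g_eq R 23 277).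
Proof.
have upper (n : nat) : (6 < n < 22)%N \/ (22 < n < 40)%N ->
    forall S : set 'rV[R]_n, spherical_two_distance S ->
    (S #<= `I_(size_bound n))%card.
  move=> n_range S S2; apply: contrapT => /(two_distance_set_family S2).
  by case=> X [a [b /(no_larger_family n_range)]].
have lower (n : nat) : (6 < n)%N -> exists2 S : set 'rV[R]_n,
    spherical_two_distance S & (S #= `I_((n * (n + 1)) %/ 2))%card.
  move=> /(midpoint_family R)[X [a [b /two_distance_family_set[S S2 Scard]]]].
  exists S => //; suff <- : 'C(n.+1, 2) = (n * (n + 1) %/ 2)%N by [].
  by rewrite bin2 /= -divn2 mulnC addn1.
split=> [n n_range|].
  split; first by apply: lower; lia.
  have := upper n; rewrite /size_bound addn1; case: eqP => [n23|_]; first by lia.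
  by apply; lia.
(* If some set has more than 276 points, 277 of them attain the upper bound; otherwise the simplex
   construction is optimal. *)
have [[S [S2 S277]]|no277] := pselect (exists S : set 'rV[R]_23,
    spherical_two_distance S /\ ~ (S #<= `I_276)%card).
  right; split; last by apply: (upper 23); right.
  by have [X [a [b /two_distance_family_set]]] := two_distance_set_family S2 S277.
left; split; first exact: lower.
by move=> S S2; apply: contrapT => S277; apply: no277; exists S.
Qed.
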